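(* Let $n\ge 2$, let $X=\operatorname{diag}(\lambda_1,\dots,\lambda_n)\in\mathfrak{gl}_n(\mathbb{C})$ be diagonal, and let $h$ be the Hessenberg function $h(i)=i+1$ for $1\le i<n$, $h(n)=n$. Let $w\in S_n$ and $1\le j<k\le n$ with $w^{-1}(j)>w^{-1}(k)$, and let $O_{w,s_{j,k}w}=\{[G_{jk}(c)w]:c\in\mathbb{C}^*\}$ be the corresponding one-dimensional orbit of the action of $T$ on $\mathrm{GL}_n(\mathbb{C})/B$ by left multiplication. If $w(w^{-1}(k)+1)=j$, then $O_{w,s_{j,k}w}\cap\mathrm{Hess}(X,h)\ne\emptyset$. Moreover, for the $T$-action on $\mathrm{Hess}(X,h)$ given by restriction of the action of $T$ on $\mathrm{GL}_n(\mathbb{C})/B$, one has $O_{w,s_{j,k}w}\subset\mathrm{Hess}(X,h)$.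
   Context: $B\subset \mathrm{GL}_n(\mathbb{C})$ is the subgroup of upper triangular matrices, $\mathrm{GL}_n(\mathbb{C})/B$ is the full flag variety, and $[g]=gB$. The torus $T=\{\operatorname{diag}(T_1,\dots,T_n):T_i\in\mathbb{C}^*\}\subset B$ acts by $s\cdot[g]=[sg]$. For $g\in\mathrm{GL}_n(\mathbb{C})$, $V_j(g)$ is the span of the first $j$ columns of $g$. For a Hessenberg function $h$ (a map $h:\{1,\dots,n\}\to\{1,\dots,n\}$ with $j\le h(j)$ and $h(j)\le h(j+1)$) and $X\in\mathfrak{gl}_n(\mathbb{C})$, the Hessenberg variety is $\mathrm{Hess}(X,h)=\{gB\in \mathrm{GL}_n(\mathbb{C})/B : X V_j(g)\subseteq V_{h(j)}(g)\ \text{for all } j\}$. When $X$ is diagonal it is a $T$-invariant subset. A permutation $w\in S_n$ is identified with the permutation matrix given by $we_i=e_{w(i)}$. $s_{j,k}$ is the transposition exchanging $j$ and $k$. For $c\in\mathbb{C}^*$, $G_{jk}(c)$ is the matrix with $1$'s on the diagonal, entry $c$ in position $(j,k)$, and $0$ elsewhere. *)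

(* Defs.v *)
From HB Require Import structures.
From mathcomp Require Import all_boot all_order all_algebra all_fingroup.
From mathcomp Require Import classical_sets reals.
From mathcomp Require Export complex.

Set Implicit Arguments.
Unset Strict Implicit.
Unset Printing Implicit Defensive.

Import GRing.Theory.
Local Open Scope classical_set_scope.
Local Open Scope ring_scope.

Section Flags.
Variables (R : realType) (n : nat).
Local Notation C := (R[i]).
Implicit Types (g s X : 'M[C]_n) (p : set 'M[C]_n).

Definition GL : set 'M[C]_n := [set g | g \in unitmx].

Definition borel : set 'M[C]_n :=
  [set b | b \in unitmx /\ forall i j : 'I_n, (j < i)%N -> b i j = 0].

(* A point of GL_n(C)/B is represented as an actual left coset gB. *)
Definition flag g : set 'M[C]_n := [set g *m b | b in borel].

Definition torus : set 'M[C]_n :=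
  [set diag_mx d | d in [set d : 'rV[C]_n | forall i, d 0 i != 0]].

Definition flag_act s p : set 'M[C]_n := [set s *m g | g in p].

Lemma flag_actE s g : flag_act s (flag g) = flag (s *m g).
Proof.
rewrite /flag_act /flag image_comp; apply: eq_imagel => b _ /=.
by rewrite mulmxA.
Qed.

Definition torus_orbit p : set (set 'M[C]_n) := [set flag_act s p | s in torus].

Definition first_cols g (m : nat) : {vspace 'cV[C]_n} :=
  <<[seq col i g | i : 'I_n <- enum 'I_n & (i < m)%N]>>%VS.

(* Indices in 'I_n are 0-based. *)
Record hessenberg_function := HessenbergFunction {
  hessenberg_fun :> 'I_n -> 'I_n;
  hessenberg_fun_ge : forall j : 'I_n, (j <= hessenberg_fun j)%N;
  hessenberg_fun_homo :
    forall i j : 'I_n, (i <= j)%N -> (hessenberg_fun i <= hessenberg_fun j)%N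
}.

(* The j : 'I_n stands for the 1-based index j.+1, whence the shifts. *)
Definition Hess X (h : hessenberg_function) : set (set 'M[C]_n) :=
  [set flag g | g in [set g | GL g /\ forall j : 'I_n,
    (linfun (mulmx X) @: first_cols g j.+1 <= first_cols g (h j).+1)%VS]].

(* [perm_mx w] has its row i equal to the w(i)-th basis vector; the matrix
   sending e_i to e_(w i) is therefore that of the inverse permutation. *)
Definition permutation_matrix (w : 'S_n) : 'M[C]_n := perm_mx w^-1%g.

Lemma permutation_matrixE (w : 'S_n) (i : 'I_n) :
  permutation_matrix w *m delta_mx i 0 = delta_mx (w i) 0 :> 'cV[C]_n.
Proof.
rewrite -colE; apply/matrixP => a b; rewrite !mxE (ord1 b) eqxx andbT.
by rewrite (canF_eq (permKV w)).
Qed.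

Definition elem_G (j k : 'I_n) (c : C) : 'M[C]_n := 1%:M + c *: delta_mx j k.

Definition orbit_O (w : 'S_n) (j k : 'I_n) : set (set 'M[C]_n) :=
  [set flag (elem_G j k c *m permutation_matrix w) | c in [set c : C | c != 0]].

End Flags.

Arguments orbit_O R {n} w j k.

(* Main.v *)
Require Import Defs.
From HB Require Import structures.
From mathcomp Require Import all_boot all_order all_algebra all_fingroup.
From mathcomp Require Import classical_sets reals.

(** Write [g := G_jk(c) w] and [p := w^-1 k]. Column [a] of [g] is the basis
vector [e_(w a)], except for column [p], which is [e_k + c e_j]. Every
other column is an eigenvector of the diagonal matrix [X], while
[X (e_k + c e_j) = lambda_k (e_k + c e_j) + c (lambda_j - lambda_k) e_j].
The hypothesis on [w] says that [e_j] is exactly the column following column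
[p], so the error term stays within the first [h p] columns: [X] moves each
flag step by at most one step ([flag_elem_G_Hess]). This holds for every [c],
so the whole orbit lies in the Hessenberg variety.

Torus stability holds because diagonal matrices commute ([Hess_act]). That
[O] is one torus orbit comes from pushing [s := diag d] to the right,
[s G_jk(1) w = G_jk(d_j / d_k) w s'] with [s'] diagonal, hence in the Borel
subgroup: [s] moves the parameter [1] to [d_j / d_k], and as [j <> k] every
non-zero [c] is such a quotient ([orbit_O_torus_orbit]). *)

Set Implicit Arguments.
Unset Strict Implicit.
Unset Printing Implicit Defensive.

Import GRing.Theory.
Local Open Scope classical_set_scope.
Local Open Scope ring_scope.

Section HessenbergFlags.
Variables (R : realType) (n : nat).
Local Notation C := (R[i]).
Implicit Types (g s X : 'M[C]_n) (d lambda : 'rV[C]_n) (w : 'S_n).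

Lemma first_cols_mul s g m :
  first_cols (s *m g) m = (linfun (mulmx s) @: first_cols g m)%VS.
Proof.
rewrite /first_cols limg_span -map_comp; congr (<<_>>%VS).
by apply: eq_map => a /=; rewrite lfunE /= !colE mulmxA.
Qed.

Lemma col_first_cols g m (a : 'I_n) : (a < m)%N -> col a g \in first_cols g m.
Proof.
by move=> lt_am; apply/memv_span/map_f; rewrite mem_filter lt_am mem_enum.
Qed.

Lemma first_cols_subv g m (V : {vspace 'cV[C]_n}) :
  (forall a : 'I_n, (a < m)%N -> col a g \in V) -> (first_cols g m <= V)%VS.
Proof.
move=> colV; apply/span_subvP => _ /mapP[a + ->].
by rewrite mem_filter => /andP[/colV].
Qed.

(** By monotonicity of [h], it is enough to control the image under [X] of the
last column of each step of the flag. *)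
Lemma Hess_flag_col X (h : hessenberg_function n) g : g \in unitmx ->
  (forall a : 'I_n, X *m col a g \in first_cols g (h a).+1) ->
  Hess X h (flag g).
Proof.
move=> g_unit Xcol; exists g => //; split=> // b.
rewrite -first_cols_mul; apply: first_cols_subv => a le_ab.
rewrite colE -mulmxA -colE.
apply: (subvP (first_cols_subv _)) (Xcol a) => e le_eh.
apply: col_first_cols; apply: leq_trans le_eh _.
by rewrite ltnS hessenberg_fun_homo.
Qed.

(** As [s] commutes with [X], applying [s] to the inclusion
[X V_a(g) <= V_(h a)(g)] gives the same inclusion for [s g]. *)
Lemma Hess_act X (h : hessenberg_function n) s p :
  s \in unitmx -> X *m s = s *m X ->
  Hess X h p -> Hess X h (flag_act s p).
Proof.
move=> s_unit XsC [g [g_unit XV] <-]; rewrite flag_actE.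
exists (s *m g) => //; split=> [|a]; first by rewrite /GL /= unitmx_mul s_unit.
rewrite -first_cols_mul mulmxA XsC -mulmxA !(first_cols_mul s).
by rewrite limgS // first_cols_mul.
Qed.

Lemma diag_mx_unit d : (forall a, d 0 a != 0) -> diag_mx d \in unitmx.
Proof.
by move=> d_neq0; rewrite unitmxE det_diag unitfE; apply/prodf_neq0.
Qed.

Lemma diag_mx_borel d : (forall a, d 0 a != 0) -> borel (diag_mx d).
Proof.
move=> d_neq0; split=> [|a b lt_ba]; first exact: diag_mx_unit.
by rewrite mxE eq_sym -val_eqE /= (ltn_eqF lt_ba) mulr0n.
Qed.

Lemma borel_mul b1 b2 : borel b1 -> borel b2 -> borel (b1 *m b2 : 'M[C]_n).
Proof.
move=> [u1 t1] [u2 t2]; split=> [|a b lt_ba]; first by rewrite unitmx_mul u1.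
rewrite mxE big1 // => e _; case: (ltnP e a) => [/t1->|le_ae].
  by rewrite mul0r.
by rewrite t2 ?mulr0 // (leq_trans lt_ba).
Qed.

(** Absorbs into the coset the diagonal factor that is left on the right once a
torus element has been moved past [G_jk(c) w]. *)
Lemma flag_mul_diag g d :
  (forall a, d 0 a != 0) -> flag (g *m diag_mx d) = flag g.
Proof.
move=> d_neq0; pose d' : 'rV[C]_n := \row_a (d 0 a)^-1.
have d'_neq0 a : d' 0 a != 0 by rewrite mxE invr_eq0.
have dd' : diag_mx d *m diag_mx d' = 1%:M.
  rewrite mulmx_diag -(diag_const_mx n 1); congr diag_mx.
  by apply/rowP=> a; rewrite !mxE divff.
apply/seteqP; split=> _ [b bB <-].
  by exists (diag_mx d *m b); rewrite ?mulmxA //; apply/borel_mul/bB/diag_mx_borel.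
exists (diag_mx d' *m b); first by apply/borel_mul/bB/diag_mx_borel.
by rewrite mulmxA -(mulmxA g) dd' mulmx1.
Qed.

Lemma elem_G_unit (j k : 'I_n) (c : C) : j != k -> elem_G j k c \in unitmx.
Proof.
move=> neq_jk; have := mulmx1_unit (_ : elem_G j k c *m elem_G j k (- c) = 1%:M).
case=> //; rewrite /elem_G mulmxDl mul1mx mulmxDr mulmx1.
rewrite -scalemxAl -scalemxAr mul_delta_mx_0 1?eq_sym // !scaler0 addr0.
by rewrite -addrA -scalerDl addNr scale0r addr0.
Qed.

Lemma elem_G_perm_unit w (j k : 'I_n) (c : C) :
  j != k -> elem_G j k c *m permutation_matrix R w \in unitmx.
Proof. by move=> /elem_G_unit Gu; rewrite unitmx_mul Gu unitmx_perm. Qed.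

Lemma col_elem_G_perm w (j k : 'I_n) (c : C) (a : 'I_n) :
  col a (elem_G j k c *m permutation_matrix R w) =
  delta_mx (w a) 0 + c *: (delta_mx j 0 *+ (w a == k)).
Proof.
rewrite colE -mulmxA permutation_matrixE /elem_G mulmxDl mul1mx.
by rewrite -scalemxAl mul_delta_mx_cond eq_sym.
Qed.

Lemma diag_mx_delta lambda (a : 'I_n) :
  diag_mx lambda *m delta_mx a 0 = lambda 0 a *: delta_mx a 0 :> 'cV[C]_n.
Proof.
rewrite mul_diag_mx; apply/matrixP=> b e; rewrite !mxE.
by case: eqVneq => [->|]; rewrite ?mulr0.
Qed.

(** The off-diagonal part of [X] in the basis of columns has the single entry
[c (lambda_j - lambda_k)], in column [w^-1 k] and row [w^-1 j]. The
bound on [w^-1 j] places this entry inside the Hessenberg space of [h],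
whatever the value of [c]. *)
Lemma flag_elem_G_Hess lambda (h : hessenberg_function n) w
    (j k : 'I_n) (c : C) : j != k -> ((w^-1)%g j <= h ((w^-1)%g k))%N ->
  Hess (diag_mx lambda) h (flag (elem_G j k c *m permutation_matrix R w)).
Proof.
move=> neq_jk le_jh; apply: Hess_flag_col => [|a]; first exact: elem_G_perm_unit.
set g := elem_G j k c *m _.
have col_a : col a g \in first_cols g (h a).+1.
  by apply: col_first_cols; rewrite ltnS hessenberg_fun_ge.
have col_j : col ((w^-1)%g j) g = delta_mx j 0.
  by rewrite col_elem_G_perm permKV (negPf neq_jk) mulr0n scaler0 addr0.
have -> : diag_mx lambda *m col a g = lambda 0 (w a) *: col a g
    + (c * (lambda 0 j - lambda 0 k)) *: (delta_mx j 0 *+ (w a == k)).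
  rewrite col_elem_G_perm mulmxDr -scalemxAr diag_mx_delta.
  case: eqVneq => [->|_]; last by rewrite !mulr0n mulmx0 !scaler0 !addr0.
  rewrite !mulr1n diag_mx_delta scalerDr -addrA; congr (_ + _).
  rewrite !scalerA -scalerDl mulrBr [lambda 0 k * c]mulrC.
  by rewrite addrC subrK.
apply/rpredD/rpredZ; first exact: rpredZ.
case: (eqVneq (w a) k) => [wa_k|_]; last by rewrite mulr0n rpred0.
rewrite mulr1n -col_j; apply: col_first_cols; rewrite ltnS.
by rewrite -(permK w a) wa_k.
Qed.

Lemma diag_mx_perm d w :
  diag_mx d *m permutation_matrix R w
  = permutation_matrix R w *m diag_mx (\row_a d 0 (w a)).
Proof.
rewrite mul_diag_mx mul_mx_diag; apply/matrixP=> a b; rewrite !mxE mulrC.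
by case: eqVneq => [<-|_]; rewrite ?mul0r ?permKV.
Qed.

Lemma diag_mx_elem_G d (j k : 'I_n) (c : C) : d 0 k != 0 ->
  diag_mx d *m elem_G j k c = elem_G j k (d 0 j * c / d 0 k) *m diag_mx d.
Proof.
move=> dk_neq0; rewrite /elem_G mulmxDr mulmxDl mulmx1 mul1mx; congr (_ + _).
rewrite mul_diag_mx mul_mx_diag; apply/matrixP=> a b; rewrite !mxE.
case: (eqVneq a j) => [->|_]; last by rewrite !mulr0 mul0r.
case: (eqVneq b k) => [->|_]; last by rewrite !mulr0 mul0r.
by rewrite !mulr1 divfK.
Qed.

Lemma flag_act_diag_elem_G d w (j k : 'I_n) (c : C) : (forall a, d 0 a != 0) ->
  flag_act (diag_mx d) (flag (elem_G j k c *m permutation_matrix R w))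
  = flag (elem_G j k (d 0 j * c / d 0 k) *m permutation_matrix R w).
Proof.
move=> d_neq0; rewrite flag_actE mulmxA diag_mx_elem_G // -mulmxA.
by rewrite diag_mx_perm mulmxA flag_mul_diag // => a; rewrite mxE.
Qed.

Lemma orbit_O_torus_orbit w (j k : 'I_n) : j != k ->
  orbit_O R w j k =
  torus_orbit (flag (elem_G j k 1 *m permutation_matrix R w)).
Proof.
move=> neq_jk; apply/seteqP; split=> [_ [c c_neq0 <-]|_ [_ [d d_neq0 <-] <-]].
  (* The one-parameter subgroup that scales only the j-th coordinate. *)
  pose d : 'rV[C]_n := \row_a (if a == j then c else 1).
  have d_neq0 a : d 0 a != 0 by rewrite mxE; case: ifP; rewrite ?oner_eq0.
  exists (diag_mx d); first by exists d.
  rewrite flag_act_diag_elem_G // !mxE eqxx eq_sym (negPf neq_jk).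
  by rewrite mulr1 divr1.
exists (d 0 j * 1 / d 0 k); last by rewrite flag_act_diag_elem_G.
by rewrite /= mulr1 mulf_neq0 ?invr_eq0.
Qed.

End HessenbergFlags.

Theorem theorem3p2 (R : realType) (n : nat) (n_ge2 : (2 <= n)%N)
    (lambda : 'rV[R[i]]_n) (h : hessenberg_function n)
    (h_succ : forall i : 'I_n, (i.+1 < n)%N -> h i = i.+1 :> nat)
    (h_last : forall i : 'I_n, i.+1 = n -> h i = i)
    (w : 'S_n) (j k : 'I_n) (lt_jk : (j < k)%N)
    (lt_wkj : ((w^-1)%g k < (w^-1)%g j)%N)
    (i : 'I_n) (i_def : i = ((w^-1)%g k).+1 :> nat) (w_i : w i = j) :
  let X := diag_mx lambda in
  let O := orbit_O R w j k in
  O `&` Hess X h !=set0 /\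
  [/\ forall s p, torus s -> Hess X h p -> Hess X h (flag_act s p),
      exists2 p, Hess X h p & O = torus_orbit p
    & O `<=` Hess X h].
Proof.
move=> X O.
have neq_jk : j != k by rewrite -val_eqE /= (ltn_eqF lt_jk).
have j_pos : (w^-1)%g j = i by rewrite -w_i permK.
have le_jh : ((w^-1)%g j <= h ((w^-1)%g k))%N.
  by rewrite j_pos h_succ -i_def.
have inHess c : Hess X h (flag (elem_G j k c *m permutation_matrix R w)).
  exact: flag_elem_G_Hess.
split.
  exists (flag (elem_G j k 1 *m permutation_matrix R w)); split=> //.
  by exists 1 => //=; rewrite oner_eq0.
split=> [s p [d d_neq0 <-] pHess||_ [c _ <-] //].
  apply: Hess_act pHess; first exact: diag_mx_unit.
  exact: diag_mxC.
by exists (flag (elem_G j k 1 *m permutation_matrix R w));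
  rewrite // /O orbit_O_torus_orbit.
Qed.
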